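(* Let $n\ge 2$ and let $f\in F(n)$ be a dead end element with respect to the generating set $\{x_0,x_1,\dots,x_{n-1}\}$. Then $f$ has depth two.
   Context: $F(n)=\langle x_0,x_1,x_2,\dots\mid x_jx_i=x_ix_{j+n-1}\text{ for }i<j\rangle$, which is generated by $S=\{x_0,x_1,\dots,x_{n-1}\}$. Let $\ell$ be the word length function of $F(n)$ with respect to $S$. An element $g$ is a dead end if $\ell(sg)\le\ell(g)$ for all $s\in S\cup S^{-1}$. A dead end element $g$ has depth $k$ if $k$ is the smallest natural number for which there exist $s_1,\dots,s_{k+1}\in S\cup S^{-1}$ with $\ell(s_1\cdots s_{k+1}\cdot g)>\ell(g)$. *)

(* Defs.v *)
From HB Require Import structures.
From mathcomp Require Import all_boot.
From mathcomp Require Import boolp classical_sets.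

Set Implicit Arguments.
Unset Strict Implicit.
Unset Printing Implicit Defensive.

Local Open Scope classical_set_scope.
Local Open Scope quotient_scope.
Local Open Scope group_scope.

(* The group < X | u = v whenever rels u v >.  In a word over X, the letter
   (x, false) stands for x and (x, true) for x^-1.                             *)
Section Presentation.
Variable X : choiceType.

Definition word := seq (X * bool).

Definition word_inv (w : word) : word := rev [seq (a.1, ~~ a.2) | a <- w].

Inductive word_equiv (rels : word -> word -> Prop) : word -> word -> Prop :=
| WordRel u v : rels u v -> word_equiv rels u v
| WordCancel x b : word_equiv rels [:: (x, b); (x, ~~ b)] [::]
| WordCat u u' v v' :
    word_equiv rels u u' -> word_equiv rels v v' ->
    word_equiv rels (u ++ v) (u' ++ v')
| WordRefl u : word_equiv rels u u
| WordSym u v : word_equiv rels u v -> word_equiv rels v u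
| WordTrans u v w :
    word_equiv rels u v -> word_equiv rels v w -> word_equiv rels u w.

Lemma word_invK : involutive word_inv.
Proof.
move=> w; rewrite /word_inv map_rev revK -map_comp.
by rewrite (@eq_map _ _ _ id) ?map_id // => -[x b] /=; rewrite negbK.
Qed.

Variable rels : word -> word -> Prop.

Lemma word_equivVl w : word_equiv rels (word_inv w ++ w) [::].
Proof.
elim: w => [|[x b] w IH]; first exact: WordRefl.
rewrite /word_inv /= rev_cons cat_rcons.
apply: WordTrans IH; apply: WordCat; first exact: WordRefl.
apply: (@WordCat _ [:: (x, ~~ b); (x, b)] [::] w w); last exact: WordRefl.
by rewrite -{2}[b]negbK; apply: WordCancel.
Qed.

Lemma word_equivVr w : word_equiv rels (w ++ word_inv w) [::].
Proof. by rewrite -{1}[w]word_invK; apply: word_equivVl. Qed.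

Lemma word_equiv_inv u v :
  word_equiv rels u v -> word_equiv rels (word_inv u) (word_inv v).
Proof.
move=> uv.
have hu : word_equiv rels (word_inv u ++ (v ++ word_inv v)) (word_inv u).
  rewrite -[X in word_equiv _ _ X]cats0; apply: WordCat.
    exact: WordRefl.
  exact: word_equivVr.
have hv : word_equiv rels (word_inv u ++ (v ++ word_inv v)) (word_inv v).
  rewrite catA; apply: (@WordCat _ _ [::]); last exact: WordRefl.
  apply: WordTrans (word_equivVl u).
  by apply: WordCat; [exact: WordRefl | exact: WordSym].
exact: WordTrans (WordSym hu) hv.
Qed.

Definition word_equivb : rel word := fun u v => `[< word_equiv rels u v >].

Fact word_equivb_refl : reflexive word_equivb.
Proof. by move=> u; apply/asboolP/WordRefl. Qed.

Fact word_equivb_sym : symmetric word_equivb.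
Proof. by move=> u v; apply/asboolP/asboolP => /WordSym. Qed.

Fact word_equivb_trans : transitive word_equivb.
Proof.
by move=> v u w /asboolP uv /asboolP vw; apply/asboolP; apply: WordTrans vw.
Qed.

Definition word_equiv_rel :=
  EquivRel word_equivb word_equivb_refl word_equivb_sym word_equivb_trans.

Definition presented : Type := {eq_quot word_equiv_rel}.

HB.instance Definition _ := Choice.copy presented {eq_quot word_equiv_rel}.

Definition word_class (w : word) : presented := \pi_{eq_quot word_equiv_rel} w.

Definition word_repr (g : presented) : word :=
  repr (g : {eq_quot word_equiv_rel}).

Lemma word_classP u v : word_class u = word_class v <-> word_equiv rels u v.
Proof.
split=> [uv|uv]; last by apply/eqmodP/asboolP.
by apply/asboolP; have /eqmodP := uv.
Qed.

Lemma word_reprK g : word_class (word_repr g) = g.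
Proof. exact: reprK. Qed.

Lemma word_classK w : word_equiv rels (word_repr (word_class w)) w.
Proof. by apply/word_classP; rewrite word_reprK. Qed.

Definition presented_one : presented := word_class [::].
Definition presented_mul (g h : presented) : presented :=
  word_class (word_repr g ++ word_repr h).
Definition presented_inv (g : presented) : presented :=
  word_class (word_inv (word_repr g)).

Fact presented_mulE u v :
  presented_mul (word_class u) (word_class v) = word_class (u ++ v).
Proof. by apply/word_classP; apply: WordCat; exact: word_classK. Qed.

Fact presented_invE u : presented_inv (word_class u) = word_class (word_inv u).
Proof. exact/word_classP/word_equiv_inv/word_classK. Qed.

Fact presented_mulA : associative presented_mul.
Proof.
move=> f g h; rewrite -(word_reprK f) -(word_reprK g) -(word_reprK h).
by rewrite !presented_mulE catA.
Qed.

Fact presented_mul1 : left_id presented_one presented_mul.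
Proof. by move=> g; rewrite -(word_reprK g) presented_mulE. Qed.

Fact presented_mulr1 : right_id presented_one presented_mul.
Proof. by move=> g; rewrite -(word_reprK g) presented_mulE cats0. Qed.

Fact presented_mulV : left_inverse presented_one presented_inv presented_mul.
Proof.
move=> g; rewrite -(word_reprK g) presented_invE presented_mulE.
exact/word_classP/word_equivVl.
Qed.

Fact presented_mulrV : right_inverse presented_one presented_inv presented_mul.
Proof.
move=> g; rewrite -(word_reprK g) presented_invE presented_mulE.
exact/word_classP/word_equivVr.
Qed.

HB.instance Definition _ := isGroup.Build presented presented_mulA
  presented_mul1 presented_mulr1 presented_mulV presented_mulrV.

Definition presented_gen (x : X) : presented := word_class [:: (x, false)].

Lemma word_class_cat u v : word_class (u ++ v) = word_class u * word_class v.
Proof. by rewrite -presented_mulE. Qed.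

Lemma word_classE w : word_class w =
  \prod_(a <- w) (if a.2 then (presented_gen a.1)^-1 else presented_gen a.1).
Proof.
elim: w => [|[x b] w IH]; first by rewrite big_nil.
rewrite big_cons -IH -cat1s word_class_cat; congr (_ * _).
by case: b => //=; rewrite [RHS]presented_invE.
Qed.

End Presentation.

Section WordMetric.
Variable G : groupType.
Implicit Types (S : set G) (g : G).

Definition letters S : set G := [set s | S s \/ S s^-1].

Definition is_product S k g := exists ss : seq G,
  [/\ size ss = k, forall s, s \in ss -> letters S s & g = \prod_(s <- ss) s].

Definition generates S := forall g, exists k, is_product S k g.

(* The minimal k such that g is a product of k letters; the default value 0 is
   only taken outside of the subgroup generated by S (see thompson_generated). *)
Definition word_length S g : nat :=
  if pselect (exists k, `[< is_product S k g >]) is left ex then ex_minn ex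
  else 0.

Definition dead_end S g :=
  forall s, letters S s -> word_length S (s * g) <= word_length S g.

Definition escapes S k g :=
  exists h, is_product S k h /\ word_length S g < word_length S (h * g).

Definition has_depth S k g :=
  escapes S k.+1 g /\ forall j, escapes S j.+1 g -> k <= j.

Lemma word_lengthP S g : generates S ->
  is_product S (word_length S g) g /\
  forall k, is_product S k g -> word_length S g <= k.
Proof.
move=> /(_ g) [k gk]; rewrite /word_length; case: pselect => [ex|[]]; last first.
  by exists k; apply/asboolP.
case: ex_minnP => m /asboolP gm min; split=> // l gl.
by apply: min; apply/asboolP.
Qed.

Lemma is_product1 S : is_product S 0 1.
Proof. by exists [::]; rewrite big_nil. Qed.

Lemma is_product_letter S s : letters S s -> is_product S 1 s.
Proof.
by move=> Ss; exists [:: s]; rewrite big_seq1; split=> // t; rewrite inE => /eqP->.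
Qed.

Lemma is_productM S k l g h :
  is_product S k g -> is_product S l h -> is_product S (k + l) (g * h).
Proof.
move=> [s [<- Ss ->]] [t [<- St ->]]; exists (s ++ t).
rewrite size_cat big_cat; split=> // r.
by rewrite mem_cat => /orP[/Ss|/St].
Qed.

Lemma lettersV S s : letters S s -> letters S s^-1.
Proof. by rewrite /letters /= invgK => -[]; [right|left]. Qed.

Lemma is_productV S k g : is_product S k g -> is_product S k g^-1.
Proof.
move=> [s [<- Ss ->]] {k g}; elim: s Ss => [|x s IH] Ss.
  by rewrite big_nil invg1; apply: is_product1.
rewrite big_cons invgM /= -addn1; apply: is_productM.
  by apply: IH => t ts; apply: Ss; rewrite inE ts orbT.
by apply/is_product_letter/lettersV/Ss; rewrite mem_head.
Qed.

End WordMetric.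

(* F(n) = < x_0, x_1, ... | x_j x_i = x_i x_(j+n-1) for i < j >.  The truncated
   subtraction is harmless since n >= 2 in all uses.                           *)
Inductive thompson_rels (n : nat) : word nat -> word nat -> Prop :=
| ThompsonRel i j : i < j ->
    thompson_rels n [:: (j, false); (i, false)]
                    [:: (i, false); ((j + n - 1)%N, false)].

Definition thompson (n : nat) : groupType := presented (thompson_rels n).

Definition thompson_x (n i : nat) : thompson n :=
  presented_gen (thompson_rels n) i.
Arguments thompson_x : clear implicits.

Definition thompson_gens (n : nat) : set (thompson n) :=
  [set thompson_x n i | i in [set i : nat | i < n]].
Arguments thompson_gens : clear implicits.

Lemma thompson_xM n i j : i < j ->
  thompson_x n j * thompson_x n i = thompson_x n i * thompson_x n (j + n - 1)%N.
Proof.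
by move=> ij; rewrite -!word_class_cat; apply/word_classP/WordRel.
Qed.

Lemma thompson_generated n : 2 <= n -> generates (thompson_gens n).
Proof.
move=> n2; have gx i : exists k, is_product (thompson_gens n) k (thompson_x n i).
  have [m] := ubnP i; elim: m i => // m IH i; rewrite ltnS => im.
  have g0 : is_product (thompson_gens n) 1 (thompson_x n 0).
    by apply: is_product_letter; left; exists 0 => //=; apply: leq_trans n2.
  have [i_n|n_i] := ltnP i n.
    by exists 1%N; apply: is_product_letter; left; exists i.
  have n0 : 0 < n by apply: ltnW.
  pose j := i - n.-1.
  have j0 : 0 < j by rewrite subn_gt0 prednK.
  have ij : (j + n - 1)%N = i.
    by rewrite /j -addnBA // subn1 subnK // (leq_trans (leq_pred n) n_i).
  have [|k gk] := IH j.
    rewrite (leq_trans _ im) // -[X in _ < X]ij -addnBA // -[X in X < _]addn0.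
    by rewrite ltn_add2l subn_gt0.
  exists (1 + (k + 1))%N; rewrite -ij -[thompson_x n _](mulKg (thompson_x n 0)).
  rewrite -thompson_xM //; apply: is_productM; first exact: is_productV.
  exact: is_productM.
move=> g; rewrite -(word_reprK g) word_classE.
elim: (word_repr g) => [|[i b] w [k wk]].
  by exists 0; rewrite big_nil; apply: is_product1.
have [l il] := gx i; rewrite big_cons; exists (l + k).
by apply: is_productM => //; case: b => //=; apply: is_productV.
Qed.

(* Main.v *)
Require Import Defs.
From mathcomp Require Import all_boot all_order all_algebra zify.
From mathcomp Require Import boolp classical_sets.

Set Implicit Arguments.
Unset Strict Implicit.
Unset Printing Implicit Defensive.

Import GRing.Theory Num.Theory Order.TTheory.

(* The relations are homogeneous, so word length changes parity under each
   generator, and a dead end f satisfies l(s f) = l(f) - 1 for every letter s: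
   one or two letters never escape.  For three letters, view f as a forest
   diagram, i.e. as a map between rows of infinite n-ary trees, x_0 moving the
   pointer by n - 1 trees and x_k (0 < k < n) joining the trees k, ..., k+n-1.
   - If tree k of f is trivial then x_k^-1 f is longer than f, and its tree k is
     again trivial.  Hence if tree n of f is trivial, x_1^-1 x_1^-1 x_0 escapes.
   - If tree n of f is nontrivial then x_(n-1) f is longer than f, so that f is
     not a dead end.
   Both points follow by surgery on a shortest path from the longer element to
   1: a marked interval is excised, and the path is projected to what happens
   on the left and on the right of that interval.  Each letter of the path costs
   at most one letter in the two projections together. *)

(** * The action on rows of trees *)

Section Action.
Variable N : nat.
Local Notation digit := 'I_N.+1.
Local Notation stream := (nat -> digit).
Local Notation point := (int * stream)%type.
Local Open Scope ring_scope.

Definition scons (i : digit) (u : stream) : stream :=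
  fun m => if m is m'.+1 then u m' else i.

Lemma sconsK (u : stream) : scons (u 0%N) (fun m => u m.+1) = u.
Proof. by apply: funext => -[]. Qed.

Lemma scons_inj i j u v : scons i u = scons j v -> i = j /\ u = v.
Proof.
move=> e; split; first exact: (congr1 (@^~ 0%N) e).
by apply: funext => m; have := congr1 (@^~ m.+1) e.
Qed.

(* The point (j, u) is the end u of the j-th tree; n = N + 1. *)
Definition shift (e : int) (z : point) : point := (z.1 + e, z.2).

Definition merge (k : int) (z : point) : point :=
  if z.1 < k then z
  else if z.1 <= k + N%:Z then (k, scons (inord `|z.1 - k|%N) z.2)
  else (z.1 - N%:Z, z.2).

Definition expand (k : int) (z : point) : point :=
  if z.1 < k then z
  else if z.1 == k then (k + (z.2 0%N)%:Z, fun m => z.2 m.+1)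
  else (z.1 + N%:Z, z.2).

Lemma mergeL k (z : point) : z.1 < k -> merge k z = z.
Proof. by rewrite /merge => ->. Qed.

Lemma mergeI k (i : digit) u : merge k (k + i%:Z, u) = (k, scons i u).
Proof.
have iN := ltn_ord i.
rewrite /merge /= ifF; last lia.
rewrite ifT; last lia.
congr (_, scons _ _); apply: val_inj; rewrite /= inordK; lia.
Qed.

Lemma mergeR k (z : point) : k + N%:Z < z.1 -> merge k z = shift (- N%:Z) z.
Proof.
move=> h; rewrite /merge.
have -> : (z.1 < k) = false by lia.
by have -> : (z.1 <= k + N%:Z) = false by lia.
Qed.

Lemma expandL k (z : point) : z.1 < k -> expand k z = z.
Proof. by rewrite /expand => ->. Qed.

Lemma expandI k i u : expand k (k, scons i u) = (k + i%:Z, u).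
Proof. by rewrite /expand /= ltxx eqxx. Qed.

Lemma expandR k (z : point) : k < z.1 -> expand k z = shift N%:Z z.
Proof.
move=> h; rewrite /expand.
have -> : (z.1 < k) = false by lia.
by have -> : (z.1 == k) = false by lia.
Qed.

(** A relation between source and image, so that one case analysis serves both [merge] and its
    inverse [expand]. *)
Variant merge_spec (k : int) : point -> point -> Prop :=
| MergeLeft (z : point) of z.1 < k : merge_spec k z z
| MergeIn (i : digit) (u : stream) : merge_spec k (k + i%:Z, u) (k, scons i u)
| MergeRight (j : int) (u : stream) of k < j : merge_spec k (j + N%:Z, u) (j, u).

Lemma mergeP k z : merge_spec k z (merge k z).
Proof.
have [zk|kz] := ltP z.1 k; first by rewrite mergeL //; constructor.
have [zN|Nz] := leP z.1 (k + N%:Z).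
  have [i e] : exists i : digit, z.1 = k + i%:Z.
    by exists (inord `|z.1 - k|%N); rewrite inordK; lia.
  by case: z e {kz zN} => j u /= ->; rewrite mergeI; constructor.
rewrite mergeR // /shift; case: z kz Nz => j u /= _ Nz.
by rewrite -{1}[j](subrK N%:Z); constructor; lia.
Qed.

Lemma mergeK k : cancel (merge k) (expand k).
Proof.
move=> z; case: mergeP => [{}z h|i u|j u h].
- by rewrite expandL.
- by rewrite expandI.
- by rewrite expandR.
Qed.

Lemma expandK k : cancel (expand k) (merge k).
Proof.
move=> [j u]; have [jk|kj|->] := ltgtP j k.
- by rewrite expandL // mergeL.
- by rewrite expandR // mergeR /shift /= ?addrK //; lia.
- by rewrite -[u]sconsK expandI mergeI.
Qed.

Lemma expandP k z : merge_spec k (expand k z) z.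
Proof. by rewrite -{2}[z](expandK k); apply: mergeP. Qed.

Lemma shift_shift d e z : shift d (shift e z) = shift (d + e) z.
Proof. by rewrite /shift /= -addrA [e + d]addrC. Qed.

Lemma shift0 z : shift 0 z = z.
Proof. by case: z => j u; rewrite /shift addr0. Qed.

Lemma shift_merge e k z : shift e (merge k z) = merge (k + e) (shift e z).
Proof.
case: mergeP => [z' h|i u|j u h].
- by rewrite mergeL //= ltrD2r.
- by rewrite /shift /= addrAC mergeI.
- by rewrite mergeR /shift /=; [congr (_, _)|]; lia.
Qed.

Lemma shift_expand e k z : shift e (expand k z) = expand (k + e) (shift e z).
Proof. by rewrite -{2}[z](expandK k) shift_merge mergeK. Qed.

(** This is the relation [x_j x_i = x_i x_(j+n-1)]: a caret over the trees [i, ..., i+N] lowers by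
    [N] the index of every tree further right. *)
Lemma merge_merge (i j : int) (z : point) : i < j ->
  merge j (merge i z) = merge i (merge (j + N%:Z) z).
Proof.
move=> ij; case: (mergeP (j + N%:Z) z) => [{}z h|k u|k u h].
- rewrite mergeL //.
  by case: (mergeP i z) h => [y yi|l u|l u il] /= h; lia.
- rewrite !(@mergeR i) /shift /=; try lia.
  have -> : j + N%:Z + k%:Z - N%:Z = j + k%:Z by lia.
  by rewrite mergeI addrK.
- rewrite !(@mergeR i) /=; try lia.
  by rewrite mergeR /shift /=; [congr (_, _)|]; lia.
Qed.
End Action.

(** * The group action on ends of trees *)

Section WordAction.
Variable N : nat.
Local Notation digit := 'I_N.+1.
Local Notation stream := (nat -> digit).
Local Notation point := (int * stream)%type.
Local Notation letter := (nat * bool)%type.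
Local Notation rels := (thompson_rels N.+1).
Local Open Scope ring_scope.

Definition lact (a : letter) : point -> point :=
  match a with
  | (0, false) => shift (- N%:Z)
  | (0, true) => shift N%:Z
  | (k.+1, false) => merge k.+1%:Z
  | (k.+1, true) => expand k.+1%:Z
  end.

Definition wact (w : word nat) (z : point) : point := foldr lact z w.

Lemma wact_cat v w z : wact (v ++ w) z = wact v (wact w z).
Proof. exact: foldr_cat. Qed.

Lemma wact_cons a w z : wact (a :: w) z = lact a (wact w z).
Proof. by []. Qed.

Lemma lactK i b z : lact (i, b) (lact (i, ~~ b) z) = z.
Proof.
case: i b => [|k] [] /=; rewrite ?mergeK ?expandK //.
  by rewrite shift_shift subrr shift0.
by rewrite shift_shift addNr shift0.
Qed.

Lemma lact_rel i j z : (i < j)%N ->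
  lact (j, false) (lact (i, false) z) =
  lact (i, false) (lact ((j + N)%N, false) z).
Proof.
case: j => // j; case: i => [|i] ij; rewrite addSn /=.
  rewrite shift_merge; congr merge; lia.
by rewrite merge_merge; [congr (merge _ (merge _ _)) | ]; lia.
Qed.

Lemma wact_equiv u v : word_equiv rels u v -> wact u =1 wact v.
Proof.
elim=> {u v}.
- move=> _ _ [i j ij] z; rewrite addnS subn1.
  exact: lact_rel.
- by move=> x b z; apply: lactK.
- by move=> u u' v v' _ IHu _ IHv z; rewrite !wact_cat IHv.
- by [].
- by move=> u v _ IH z.
- by move=> u v w _ IHu _ IHv z; rewrite IHu.
Qed.

Definition act (g : thompson N.+1) : point -> point := wact (word_repr g).

Lemma act_class w : act (word_class rels w) =1 wact w.
Proof. by move=> z; apply: wact_equiv; apply: word_classK. Qed.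

Lemma actM g h z : act (g * h)%g z = act g (act h z).
Proof.
by rewrite -(word_reprK g) -(word_reprK h) -word_class_cat !act_class wact_cat.
Qed.

Lemma act1 z : act 1%g z = z.
Proof. by rewrite (act_class [::]). Qed.

Lemma actVK g : cancel (act g^-1%g) (act g).
Proof. by move=> z; rewrite -actM mulgV act1. Qed.

Lemma actKV g : cancel (act g) (act g^-1%g).
Proof. by move=> z; rewrite -actM mulVg act1. Qed.

Lemma act_inj g : injective (act g).
Proof. exact: can_inj (actKV g). Qed.

Lemma act_x i z : act (thompson_x N.+1 i) z = lact (i, false) z.
Proof. by rewrite act_class. Qed.

Lemma act_xV i z : act (thompson_x N.+1 i)^-1%g z = lact (i, true) z.
Proof.
apply: (can_inj (actKV (thompson_x N.+1 i))).
by rewrite actVK act_x (lactK i false).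
Qed.

(** * Fractions and sorted positive words *)

Local Notation x := (thompson_x N.+1).
Local Open Scope group_scope.

Definition positive (p : seq nat) : thompson N.+1 := \prod_(i <- p) x i.

Lemma positive_cons i p : positive (i :: p) = x i * positive p.
Proof. exact: big_cons. Qed.

Lemma x_rel i j : (i < j)%N -> x j * x i = x i * x (j + N)%N.
Proof. by move/(@thompson_xM N.+1) => ->; rewrite addnS subn1. Qed.

(** The inverse letter travels right until it cancels or leaves the word: [x_i^-1 x_j] is
    [x_(j+N) x_i^-1] if [i < j], and [x_j x_(i+N)^-1] if [j < i]. *)
Lemma positive_leftV i p :
  exists p' q, (x i)^-1 * positive p = positive p' * (positive q)^-1.
Proof.
elim: p i => [|j p IH] i.
  by exists [::], [:: i]; rewrite /positive big_nil big_seq1 mulg1 mul1g.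
rewrite positive_cons; have [ij|ji|->] := ltngtP i j.
- have [p' [q e]] := IH i; exists ((j + N)%N :: p'), q.
  rewrite positive_cons -mulgA -e !mulgA; congr (_ * _).
  by apply: (mulgI (x i)); rewrite mulgA mulgV mul1g mulgA -x_rel // mulgK.
- have [p' [q e]] := IH (i + N)%N; exists (j :: p'), q.
  rewrite positive_cons -mulgA -e !mulgA; congr (_ * _).
  by apply: (mulgI (x i)); rewrite mulgA mulgV mul1g mulgA x_rel // mulgK.
- by exists p, [::]; rewrite /positive big_nil invg1 mulg1 mulKg.
Qed.

Lemma fraction g : exists p q, g = positive p * (positive q)^-1.
Proof.
rewrite -(word_reprK g) word_classE.
elim: (word_repr g) => [|[i b] w [p [q IH]]].
  by exists [::], [::]; rewrite /positive !big_nil invg1 mulg1.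
rewrite big_cons {}IH /=; case: b; last first.
  by exists (i :: p), q; rewrite positive_cons mulgA.
have [p' [q' e]] := positive_leftV i p.
exists p', (q ++ q'); rewrite mulgA e /positive big_cat invgM mulgA //.
Qed.

(** Insertion sort by the relations: a letter gains [N] in index each time it passes a smaller
    one. *)
Lemma positive_sort p :
  exists p', sorted leq p' /\ positive p' = positive p.
Proof.
elim: p => [|i p [p' [sp' e]]]; first by exists [::].
rewrite positive_cons -e {e}.
suff [q [sq eq _]] : exists q, [/\ sorted leq q, positive q = x i * positive p' &
    forall m, (m <= i)%N -> all (leq m) p' -> all (leq m) q].
  by exists q.
elim: p' i sp' => {p} [|j p IH] i /=.
  by exists [:: i]; split=> //= [|m ->]; rewrite // /positive !(big_cons, big_nil).
rewrite path_sortedE; last exact: leq_trans.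
move=> /andP[jp sp]; have [ij|ji] := leqP i j.
  exists (i :: j :: p); split; rewrite ?positive_cons //=.
    by rewrite ij path_sortedE ?jp //; apply: leq_trans.
  by move=> m -> /andP[-> ->].
have [q [sq eq hq]] := IH (i + N)%N sp.
exists (j :: q); split=> /=.
- rewrite path_sortedE ?sq ?andbT; last exact: leq_trans.
  by apply: hq jp; rewrite (leq_trans (ltnW ji)) ?leq_addr.
- by rewrite !positive_cons eq !mulgA (x_rel ji).
- move=> m mi /andP[mj mp]; rewrite mj /=; apply: hq mp.
  by rewrite (leq_trans mi) ?leq_addr.
Qed.

(** * Faithfulness of the action *)

Hypothesis N0 : (0 < N)%N.

(* The end of tree i whose digits are all N; a positive word in letters x_k with
   k >= i moves it if and only if it uses x_i. *)
Definition probe i : point := (i%:Z, fun=> ord_max).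

(** A certificate of having left the probe that survives all later letters [x_k] with [k >= i]: a
    negative tree index after [x_0], a leading digit 0 in place of [N] after the other [x_i]. *)
Definition probe_moved i (z : point) :=
  if i == 0%N then (z.1 < 0)%R else (z.1 == i%:Z) && (z.2 0%N == ord0).

Lemma probe_movedN i : ~~ probe_moved i (probe i).
Proof.
rewrite /probe_moved /=; case: eqP => [->//|_].
by rewrite eqxx /= -val_eqE /= -lt0n.
Qed.

Lemma probe_fixed i k : (i < k)%N -> lact (k, false) (probe i) = probe i.
Proof. by case: k => // k ik; rewrite /= mergeL //= ltz_nat. Qed.

Lemma probe_moved_step i z :
  z = probe i \/ probe_moved i z -> probe_moved i (lact (i, false) z).
Proof.
rewrite /probe_moved; case: i => [|i] /=.
  by case=> [->|] /=; lia.
have e u : merge i.+1%:Z (i.+1%:Z, u) = (i.+1%:Z, scons (ord0 : digit) u).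
  by rewrite -mergeI addr0.
case=> [->|/andP[/eqP]]; first by rewrite /probe e /= eqxx.
by case: z => j u /= -> _; rewrite e /= eqxx.
Qed.

Lemma probe_moved_stay i k z : (i < k)%N ->
  probe_moved i z -> probe_moved i (lact (k, false) z).
Proof.
rewrite /probe_moved; case: k => // k ik /=; case: eqP => [_ z0|_ /andP[/eqP z1 z0]].
  by rewrite mergeL //; lia.
by rewrite mergeL ?z1 ?eqxx //; lia.
Qed.

Lemma act_positive_cons i p z :
  act (positive (i :: p)) z = lact (i, false) (act (positive p) z).
Proof. by rewrite positive_cons actM act_x. Qed.

Lemma act_positive_probe i p : all (leq i) p ->
  act (positive p) (probe i) = probe i \/ probe_moved i (act (positive p) (probe i)).
Proof.
elim: p => [|j p IH] /=; first by rewrite /positive big_nil act1; left.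
move=> /andP[ij /IH h]; rewrite act_positive_cons.
move: ij h; rewrite leq_eqVlt => /predU1P[<-|ij] h.
  by right; apply: probe_moved_step.
case: h => [->|h]; first by left; rewrite probe_fixed.
by right; apply: probe_moved_stay.
Qed.

Lemma act_positive_probe_lt i p : all (ltn i) p ->
  act (positive p) (probe i) = probe i.
Proof.
elim: p => [|j p IH] /=; first by rewrite /positive big_nil act1.
by move=> /andP[ij /IH h]; rewrite act_positive_cons h probe_fixed.
Qed.

Lemma act_positive_head i p q : all (leq i) p -> all (ltn i) q ->
  ~ act (positive (i :: p)) =1 act (positive q).
Proof.
move=> ip iq /(_ (probe i)); rewrite (act_positive_probe_lt iq) act_positive_cons.
move=> e; have := probe_moved_step (act_positive_probe ip).
by rewrite e (negPf (probe_movedN i)).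
Qed.

(** If the heads differ, the probe at the smaller one is moved by one word and fixed by the other;
    equal heads cancel. *)
Lemma act_positive_inj p q : sorted leq p -> sorted leq q ->
  act (positive p) =1 act (positive q) -> p = q.
Proof.
have sE i r : sorted leq (i :: r) = all (leq i) r && sorted leq r.
  by rewrite /= path_sortedE //; apply: leq_trans.
have lt_all i j r : (i < j)%N -> all (leq j) r -> all (ltn i) (j :: r).
  move=> ij jr; rewrite /= ij /=; apply: sub_all jr => k; exact: leq_trans.
elim: p q => [|i p IH] [|j q] //.
- by rewrite sE => _ /andP[jq _] /fsym/act_positive_head [].
- by rewrite sE => /andP[ip _] _ /act_positive_head [].
rewrite !sE => /andP[ip sp] /andP[jq sq] e.
have [ij|ji|ij] := ltngtP i j.
- by case: (act_positive_head ip (lt_all _ _ _ ij jq) e).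
- by case: (act_positive_head jq (lt_all _ _ _ ji ip) (fsym e)).
rewrite -ij in e *; congr (_ :: _); apply: IH => // z; apply: (act_inj (g := x i)).
by rewrite -!actM -!positive_cons.
Qed.

(** [h^-1 * g] is a fraction with trivial action, so its numerator and denominator have the same
    sorted form. *)
Lemma act_faithful g h : act g =1 act h -> g = h.
Proof.
move=> gh; have [p [q e]] := fraction (h^-1 * g).
have [p' [sp' ep]] := positive_sort p; have [q' [sq' eq]] := positive_sort q.
apply: (mulgI h^-1); rewrite mulVg e -ep -eq.
suff -> : p' = q' by rewrite mulgV.
apply: act_positive_inj => // z; rewrite ep eq -[positive p](mulgVK (positive q)).
by rewrite -e !actM gh actKV.
Qed.
End WordAction.

(** * Projecting a path to the left of an interval *)

Section Excision.
Variable N : nat.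
Local Notation digit := 'I_N.+1.
Local Notation stream := (nat -> digit).
Local Notation point := (int * stream)%type.
Local Notation letter := (nat * bool)%type.
Local Open Scope ring_scope.

Lemma expand_merge (j k : int) (z : point) : k + N%:Z < j ->
  expand (j - N%:Z) (merge k z) = merge k (expand j z).
Proof.
move=> kj; apply: (can_inj (mergeK (j - N%:Z))).
rewrite expandK merge_merge; last lia.
by rewrite subrK expandK.
Qed.

Lemma expand_expand (j k : int) (z : point) : k < j ->
  expand (j + N%:Z) (expand k z) = expand k (expand j z).
Proof.
move=> kj; apply: (can_inj (mergeK (j + N%:Z))); rewrite expandK.
by apply: (can_inj (mergeK k)); rewrite -merge_merge // !expandK.
Qed.

(* With a digit d, the pair (j, u) denotes the end (j, u d d d ...); the left end
   of an interval has d = 0, its right end d = N. *)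
Definition edge := (int * seq digit)%type.

Definition point_of (d : digit) (e : edge) : point :=
  (e.1, foldr (@scons N) (fun=> d) e.2).

Definition edge_act (d : digit) (a : letter) (e : edge) : edge :=
  match a with
  | (0, false) => (e.1 - N%:Z, e.2)
  | (0, true) => (e.1 + N%:Z, e.2)
  | (k.+1, false) =>
      if e.1 < k.+1%:Z then e
      else if e.1 <= k.+1%:Z + N%:Z
           then (k.+1%:Z, inord `|e.1 - k.+1%:Z|%N :: e.2)
      else (e.1 - N%:Z, e.2)
  | (k.+1, true) =>
      if e.1 < k.+1%:Z then e
      else if e.1 == k.+1%:Z
           then (k.+1%:Z + (head d e.2)%:Z, behead e.2)
      else (e.1 + N%:Z, e.2)
  end.

Lemma point_of_act d a e : point_of d (edge_act d a e) = lact a (point_of d e).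
Proof.
rewrite /point_of; case: a e => [[|k] []] [j u] //=; rewrite /merge /expand /=.
  by case: ltgtP => // _; case: u.
by case: ifP => //; case: ifP.
Qed.

Definition sidelt (left : bool) (i j : int) := if left then i < j else j < i.

(* A path g and its projection l to one side of a marker: E and E' forget the
   carets straddling the marker, which they put at the tree c, resp. c'.  The
   projected path only shifts what is beyond the marker. *)
Definition sim (left : bool) (g l E : point -> point) (c : int)
    (E' : point -> point) (c' : int) :=
  [/\ exists2 q : int, c' = c + q * N%:Z &
        forall z, ~~ sidelt left z.1 c -> l z = shift (q * N%:Z) z,
      forall z, sidelt left z.1 c -> sidelt left (l z).1 c' &
      forall z, sidelt left (E z).1 c -> E' (g z) = l (E z)].

Lemma sim_id left E c : sim left id id E c E c.
Proof.
by split=> //; exists 0; rewrite ?mul0r ?addr0 // => z _; rewrite shift0.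
Qed.

Lemma sim_comp left g l E c g' l' E' c' E'' c'' :
  sim left g l E c E' c' -> sim left g' l' E' c' E'' c'' ->
  sim left (g' \o g) (l' \o l) E c E'' c''.
Proof.
move=> [[q cq sq] hl hE] [[q' cq' sq'] hl' hE']; split.
- exists (q + q') => [|z zc /=]; first lia.
  rewrite sq // sq' ?shift_shift; first by congr shift; lia.
  by move: zc; rewrite /sidelt /=; case: left {hl hE hl' hE' sq sq'}; lia.
- by move=> z /hl /hl'.
- by move=> z h /=; rewrite hE' hE //; apply: hl.
Qed.

Lemma sim_shift (q : int) left g E c E' e : e = q * N%:Z ->
  (forall z, sidelt left (E z).1 c -> E' (g z) = shift e (E z)) ->
  sim left g (shift e) E c E' (c + e).
Proof.
move=> -> h; split=> //; first by exists q.
by move=> z; rewrite /sidelt /=; case: left {h}; lia.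
Qed.

Lemma sim_silent left g E c E' c' : c' = c ->
  (forall z, sidelt left (E z).1 c -> E' (g z) = E z) ->
  sim left g id E c E' c'.
Proof.
move=> -> h; split=> //; exists 0; rewrite ?mul0r ?addr0 // => z _.
by rewrite shift0.
Qed.

(** Bounds the letters that the left projection spends on [a] when the left edge is in tree [j]. The
    thresholds are such that [costR] is not due at the same time. *)
Definition costL (a : letter) (j : int) : bool :=
  match a with
  | (0, false) => N%:Z < j
  | (0, true) => 0 < j
  | (k.+1, false) => k.+1%:Z + N%:Z < j
  | (k.+1, true) => k.+1%:Z < j
  end.

Definition costR (a : letter) (j : int) : bool :=
  match a with
  | (0, false) => j <= N%:Z
  | (0, true) => j <= 0
  | (k.+1, false) => j <= N%:Z
  | (k.+1, true) => j <= k.+1%:Z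
  end.

(* Removes the carets on the branch leading to the left end (j, u); afterwards
   that end is the left end of the tree markL j u. *)
Fixpoint dissolveL (j : int) (u : seq digit) (z : point) : point :=
  if u is i :: u' then dissolveL (j + i%:Z) u' (expand j z) else z.

Fixpoint markL (j : int) (u : seq digit) : int :=
  if u is i :: u' then markL (j + i%:Z) u' else j.

Lemma markL_ge j u : j <= markL j u.
Proof. by elim: u j => //= i u IH j; apply: le_trans (IH _); lia. Qed.

Lemma markL_shift e j u : markL (j + e) u = markL j u + e.
Proof. by elim: u j => //= i u IH j; rewrite addrAC IH. Qed.

Lemma dissolveL_shift e j u z :
  dissolveL (j + e) u (shift e z) = shift e (dissolveL j u z).
Proof. by elim: u j z => //= i u IH j z; rewrite -shift_expand addrAC IH. Qed.

Lemma dissolveL_merge k j u z : k + N%:Z < j ->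
  dissolveL (j - N%:Z) u (merge k z) = merge k (dissolveL j u z).
Proof.
elim: u j z => //= i u IH j z kj; rewrite expand_merge // addrAC IH //; lia.
Qed.

Lemma dissolveL_expand k j u z : k < j ->
  dissolveL (j + N%:Z) u (expand k z) = expand k (dissolveL j u z).
Proof.
elim: u j z => //= i u IH j z kj; rewrite expand_expand // addrAC IH //; lia.
Qed.

Lemma dissolveL_le j u (z : point) : (dissolveL j u z).1 < markL j u -> z.1 <= j.
Proof.
elim: u j z => /= [|i u IH] j z; first exact: ltW.
move=> /IH; have [//|jz] := leP z.1 j; rewrite expandR //=.
have := ltn_ord i; lia.
Qed.

(** Opening tree [j] leaves the points on its left alone and keeps all others at [j] or beyond. *)
Lemma dissolveL_zeros c (j : int) (z : point) :
  (dissolveL j (nseq c ord0) z).1 < j -> dissolveL j (nseq c ord0) z = z.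
Proof.
elim: c z => //= c IH z; rewrite addr0 => /[dup] /IH ->.
have [zj|jz] := ltP z.1 j; first by rewrite expandL.
case: expandP jz => /= *; lia.
Qed.

(* The pointer of the left path stays at the block of the marker when the pointer
   of the full path, which is at the block 1, ..., N, is to the right of it: m is
   the number of blocks between the two. *)
Definition wfL (j m : int) :=
  (m == 0) && (1 <= j) || (j <= 0) && (1 <= j + m * N%:Z <= N%:Z).
Definition normL (e : edge) (m : int) (z : point) :=
  shift (m * N%:Z) (dissolveL e.1 e.2 z).
Definition posL (e : edge) (m : int) := markL e.1 e.2 + m * N%:Z.

Definition generator_word (w : word nat) := all (fun a => a.1 <= N)%N w.

Lemma small_multiple (m : int) : - N%:Z < m * N%:Z < N%:Z -> m = 0.
Proof. by nia. Qed.

(** A caret beyond the left edge or straddling it is skipped, a caret wholly on its left is copied,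
    and a pointer move is either copied or counted in [m]. *)
Lemma simL_letter a e m : (a.1 <= N)%N -> wfL e.1 m ->
  exists l m', [/\ wfL (edge_act ord0 a e).1 m', (size l <= costL a e.1)%N,
    generator_word l &
    sim true (lact a) (wact l) (normL e m) (posL e m)
      (normL (edge_act ord0 a e) m') (posL (edge_act ord0 a e) m')].
Proof.
case: a e => [[|k] b] [j u] /= aN; rewrite /wfL /normL /posL /=.
- move=> wf; case: b => /=.
  + have [j0|j0] := ltP 0 j.
      have m0 : m = 0 by lia.
      exists [:: (0%N, true)], 0; split=> //; first lia.
      rewrite m0 !mul0r !addr0 markL_shift.
      apply: (sim_shift (q := 1)) => [|z _]; first by rewrite mul1r.
      by rewrite !shift0 dissolveL_shift.
    exists [::], (m - 1); split=> //.
      have [jN|jN] := leP (j + N%:Z) 0; first by lia.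
      have /small_multiple : - N%:Z < (m - 1) * N%:Z < N%:Z by lia.
      lia.
    apply: sim_silent => [|z _]; first by rewrite markL_shift; lia.
    rewrite dissolveL_shift shift_shift; congr shift; lia.
  + have [j0|j0] := ltP N%:Z j.
      have m0 : m = 0 by lia.
      exists [:: (0%N, false)], 0; split=> //; first lia.
      rewrite m0 !mul0r !addr0 markL_shift.
      apply: (sim_shift (q := -1)) => [|z _]; first by rewrite mulN1r.
      by rewrite !shift0 dissolveL_shift.
    exists [::], (m + 1); split=> //.
      lia.
    apply: sim_silent => [|z _]; first by rewrite markL_shift; lia.
    rewrite dissolveL_shift shift_shift; congr shift; lia.
- move=> wf; case: b => /=.
  + have [jk|kj|jk] := ltgtP j k.+1%:Z.
    * exists [::], m; split=> //; apply: sim_silent => //= z h.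
      by rewrite expandL //; have := @dissolveL_le j u z; lia.
    * have m0 : m = 0 by lia.
      exists [:: (k.+1, true)], 0; split=> //=; [lia|by rewrite aN|].
      rewrite m0 !mul0r !addr0 markL_shift; have := markL_ge j u; split=> /=.
      - exists 1; rewrite ?mul1r // => z h; rewrite expandR //; lia.
      - move=> z h; case: expandP h => [y|i v|i v] /=; [lia| |lia].
        by have := ltn_ord i; lia.
      - by move=> z _; rewrite !shift0 dissolveL_expand.
    * have m0 : m = 0 by lia.
      subst j m; exists [::], 0; split=> //=.
      (* On an exhausted sequence the branch follows child 0, which is again tree [k.+1]; nothing on
         its left moves. *)
      case: u => [|i u] /=; last by apply: sim_silent.
      apply: sim_silent; rewrite ?addr0 //= => z h; rewrite !shift0 expandL //.
      lia.
  + have [jk|kj] := ltP j k.+1%:Z.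
      exists [::], m; split=> //; apply: sim_silent => //= z h.
      by rewrite mergeL //; have := @dissolveL_le j u z; lia.
    have m0 : m = 0 by lia.
    rewrite m0; have [jN|Nj] := leP j (k.+1%:Z + N%:Z).
      exists [::], 0; split=> //=.
      have je : k.+1%:Z + (inord `|j - k.+1%:Z| : digit)%:Z = j.
        by rewrite inordK; lia.
      by apply: sim_silent => [|z _]; rewrite je ?mergeK.
    exists [:: (k.+1, false)], 0; split=> //=; [lia|by rewrite aN|].
    rewrite !mul0r !addr0 markL_shift; have := markL_ge j u; split=> /=.
    - exists (-1); rewrite ?mulN1r // => z h; rewrite mergeR //; lia.
    - by move=> z h; case: mergeP h => /= *; lia.
    - by move=> z _; rewrite !shift0 dissolveL_merge.
Qed.
End Excision.

(** * Projecting a path to the right of an interval *)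

Section ExcisionRight.
Variable N : nat.
Local Notation digit := 'I_N.+1.
Local Notation stream := (nat -> digit).
Local Notation point := (int * stream)%type.
Local Notation letter := (nat * bool)%type.
Local Open Scope ring_scope.

Local Notation edge := (edge N).
Local Notation generator_word := (generator_word N).

(* The shift keeps the indices of the trees on the right of j. *)
Fixpoint dissolveR (j : int) (u : seq digit) (z : point) : point :=
  if u is i :: u' then
    dissolveR (j + i%:Z - N%:Z) u' (shift (- N%:Z) (expand j z))
  else z.

Fixpoint markR (j : int) (u : seq digit) : int :=
  if u is i :: u' then markR (j + i%:Z - N%:Z) u' else j.

Lemma markR_le j u : markR j u <= j.
Proof.
elim: u j => //= i u IH j; apply: le_trans (IH _) _; have := ltn_ord i; lia.
Qed.

Lemma markR_shift e j u : markR (j + e) u = markR j u + e.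
Proof. by elim: u j => //= i u IH j; rewrite -IH; congr markR; lia. Qed.

Lemma dissolveR_shift e j u z :
  dissolveR (j + e) u (shift e z) = shift e (dissolveR j u z).
Proof.
elim: u j z => //= i u IH j z.
have -> : j + e + i%:Z - N%:Z = j + i%:Z - N%:Z + e by lia.
by rewrite -IH -shift_expand !shift_shift [e + _]addrC.
Qed.

Lemma expand_merge_above (j k : int) (z : point) : j < k ->
  expand j (merge k z) = merge (k + N%:Z) (expand j z).
Proof.
move=> jk; apply: (can_inj (mergeK j)).
by rewrite expandK -merge_merge // expandK.
Qed.

Lemma dissolveR_merge (k j : int) u z : j < k ->
  dissolveR j u (merge k z) = merge k (dissolveR j u z).
Proof.
elim: u j z => //= i u IH j z jk; have iN := ltn_ord i.
by rewrite expand_merge_above // shift_merge addrK IH //; lia.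
Qed.

Lemma dissolveR_expand (k j : int) u z : j < k ->
  dissolveR j u (expand k z) = expand k (dissolveR j u z).
Proof.
move=> jk; apply: (can_inj (mergeK k)).
by rewrite -dissolveR_merge // !expandK.
Qed.

Lemma dissolveR_ge j u (z : point) : markR j u < (dissolveR j u z).1 -> j <= z.1.
Proof.
elim: u j z => /= [|i u IH] j z; first exact: ltW.
move=> /IH; have [//|zj] := leP j z.1; rewrite expandL //=.
have := ltn_ord i; lia.
Qed.

Lemma dissolveR_tops c (j : int) (z : point) :
  j < (dissolveR j (nseq c ord_max) z).1 ->
  dissolveR j (nseq c ord_max) z = z.
Proof.
elim: c z => //= c IH z; rewrite addrK => /[dup] /IH ->.
have [zj|jz] := leP z.1 j; last first.
  by rewrite expandR // shift_shift addNr shift0.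
case: expandP zj => [y|i v|i v] /=; have := leq_ord ord_max; try lia.
by have := ltn_ord i; lia.
Qed.

(** Mirror image of [wfL]: when the marker is beyond the block [1, ..., N], the right path stays [m]
    blocks ahead, at the block of the marker. *)
Definition wfR (j m : int) :=
  (m == 0) && (j <= N%:Z) || (N%:Z < j) && (1 <= j - m * N%:Z <= N%:Z).
Definition normR (e : edge) (m : int) (z : point) :=
  shift (- (m * N%:Z)) (dissolveR e.1 e.2 z).
Definition posR (e : edge) (m : int) := markR e.1 e.2 - m * N%:Z.

(** Trees are indexed from the left, so a caret closed or opened at or before the edge displaces the
    right side by [N], like a pointer move. This costs [x_0] or its inverse only if the edge is in
    the block [1, ..., N] both before and after; otherwise it changes [m]. *)
Lemma simR_letter a e m : (a.1 <= N)%N -> wfR e.1 m ->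
  exists l m', [/\ wfR (edge_act ord_max a e).1 m', (size l <= costR N a e.1)%N,
    generator_word l &
    sim false (lact a) (wact l) (normR e m) (posR e m)
      (normR (edge_act ord_max a e) m') (posR (edge_act ord_max a e) m')].
Proof.
case: a e => [[|k] b] [j u] /= aN; rewrite /wfR /normR /posR /=.
- move=> wf; case: b => /=.
  + have [j0|j0] := leP j 0.
      have m0 : m = 0 by lia.
      exists [:: (0%N, true)], 0; split=> //; first lia.
      rewrite m0 !mul0r oppr0 !addr0 markR_shift.
      apply: (sim_shift (q := 1)) => [|z _]; first by rewrite mul1r.
      by rewrite !shift0 dissolveR_shift.
    exists [::], (m + 1); split=> //=; first by lia.
    apply: sim_silent => [|z _]; first by rewrite markR_shift; lia.
    rewrite dissolveR_shift shift_shift; congr shift; lia.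
  + have [j0|j0] := leP j N%:Z.
      have m0 : m = 0 by lia.
      exists [:: (0%N, false)], 0; split=> //; first lia.
      rewrite m0 !mul0r oppr0 !addr0 markR_shift.
      apply: (sim_shift (q := -1)) => [|z _]; first by rewrite mulN1r.
      by rewrite !shift0 dissolveR_shift.
    exists [::], (m - 1); split=> //.
      have [jN|jN] := ltP N%:Z (j - N%:Z); first by lia.
      have /small_multiple : - N%:Z < (m - 1) * N%:Z < N%:Z by lia.
      lia.
    apply: sim_silent => [|z _]; first by rewrite markR_shift; lia.
    rewrite dissolveR_shift shift_shift; congr shift; lia.
- move=> wf; case: b => /=.
  + have [jk|kj|jk] := ltgtP j k.+1%:Z.
    * have m0 : m = 0 by lia.
      exists [:: (k.+1, true)], 0; split=> //=; [lia|by rewrite aN|].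
      rewrite m0 !mul0r oppr0 !addr0; have := markR_le j u; split=> /=.
      - exists 0; rewrite ?mul0r ?addr0 // => z h.
        by rewrite shift0 expandL //; lia.
      - by move=> z h; case: expandP h => [y|i v|i v] /=; lia.
      - by move=> z _; rewrite !shift0 dissolveR_expand.
    * exists [::], (m + 1); split=> //=; first by lia.
      apply: sim_silent => /= [|z h]; first by rewrite markR_shift; lia.
      rewrite expandR; last by have := @dissolveR_ge j u z; lia.
      rewrite dissolveR_shift shift_shift; congr shift; lia.
    * have m0 : m = 0 by lia.
      subst j m; case: u => [|i u] /=.
        exists [::], 1; split=> //=; first by lia.
        apply: sim_silent => /= [|z h]; first lia.
        rewrite expandR; last by lia.
        by rewrite !shift_shift; congr shift; lia.
      have [iN|Ni] := leP (k.+1%:Z + i%:Z) N%:Z.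
        exists [:: (0%N, true)], 0; split=> //=.
        have -> : markR (k.+1%:Z + i%:Z) u - 0 * N%:Z =
                    markR (k.+1%:Z + i%:Z - N%:Z) u - 0 * N%:Z + N%:Z.
          by rewrite (markR_shift (- N%:Z)); lia.
        apply: (sim_shift (q := 1)) => [|z _]; first by rewrite mul1r.
        by rewrite dissolveR_shift !shift_shift; congr shift; lia.
      exists [::], 1; split=> //=; first by have := ltn_ord i; lia.
      apply: sim_silent => /= [|z h]; first by rewrite (markR_shift (- N%:Z)); lia.
      by rewrite dissolveR_shift !shift_shift; congr shift; lia.
  + have [jk|kj] := ltP j k.+1%:Z.
      have m0 : m = 0 by lia.
      exists [:: (k.+1, false)], 0; split=> //=; [lia|lia|by rewrite aN|].
      rewrite m0 !mul0r oppr0 !addr0; have := markR_le j u; split=> /=.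
      - exists 0; rewrite ?mul0r ?addr0 // => z h.
        by rewrite shift0 mergeL //; lia.
      - by move=> z h; case: mergeP h => [y|i v|i v] /=; lia.
      - by move=> z _; rewrite !shift0 dissolveR_merge.
    have [jN|Nj] := leP j (k.+1%:Z + N%:Z); last first.
      exists [::], (m - 1); split=> //=.
        have [jN|jN] := ltP N%:Z (j - N%:Z); first by lia.
        have /small_multiple : - N%:Z < (m - 1) * N%:Z < N%:Z by lia.
        lia.
      apply: sim_silent => /= [|z h]; first by rewrite markR_shift; lia.
      rewrite mergeR; last by have := @dissolveR_ge j u z; lia.
      rewrite dissolveR_shift shift_shift; congr shift; lia.
    have je : k.+1%:Z + (inord `|j - k.+1%:Z| : digit)%:Z = j.
      by rewrite inordK; lia.
    have [j1|j1] := leP j N%:Z.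
      have m0 : m = 0 by lia.
      exists [:: (0%N, false)], 0; split=> //=; first lia.
      rewrite je m0 markR_shift !mul0r oppr0 !addr0.
      apply: (sim_shift (q := -1)) => [|z _]; first by rewrite mulN1r.
      by rewrite mergeK dissolveR_shift !shift0.
    have m1 : m = 1.
      have /small_multiple : - N%:Z < (m - 1) * N%:Z < N%:Z by lia.
      lia.
    exists [::], 0; split=> //=; first lia.
    apply: sim_silent => [|z _]; rewrite je ?markR_shift; first lia.
    by rewrite mergeK dissolveR_shift shift_shift; congr shift; lia.
Qed.
End ExcisionRight.

(** * Shortcuts *)

Section Surgery.
Variable N : nat.
Local Notation digit := 'I_N.+1.
Local Notation stream := (nat -> digit).
Local Notation point := (int * stream)%type.
Local Notation letter := (nat * bool)%type.
Local Open Scope ring_scope.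

Local Notation edge := (edge N).
Local Notation generator_word := (generator_word N).

(** Compares the ends [u 000...] and [v NNN...] lexicographically; hence an exhausted side makes the
    comparison true. *)
Fixpoint seq_le (u v : seq digit) : bool :=
  match u, v with
  | i :: u', j :: v' => (i < j)%N || (i == j) && seq_le u' v'
  | _, _ => true
  end.

Lemma seq_le_nil u : seq_le u [::].
Proof. by case: u. Qed.

Definition edge_le (e e' : edge) :=
  (e.1 < e'.1) || (e.1 == e'.1) && seq_le e.2 e'.2.

Lemma edge_le_fst e e' : edge_le e e' -> e.1 <= e'.1.
Proof. by rewrite /edge_le; case: ltgtP. Qed.

Lemma seq_le_refl u : seq_le u u.
Proof. by elim: u => //= i u ->; rewrite eqxx orbT. Qed.

Lemma edge_le_refl e : edge_le e e.
Proof. by rewrite /edge_le eqxx seq_le_refl orbT. Qed.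

Lemma edge_le_act a e e' : edge_le e e' ->
  edge_le (edge_act ord0 a e) (edge_act ord_max a e').
Proof.
rewrite /edge_le; case: a e e' => [[|k] []] [j u] [j' u'] /=.
- by rewrite ltrD2r (inj_eq (addIr _)).
- by rewrite ltrD2r (inj_eq (addIr _)).
- have hd (d : digit) v : (head d v <= N)%N by rewrite -ltnS ltn_ord.
  have [jK|Kj|jK] := ltgtP j k.+1%:Z; have [jK'|Kj'|jK'] := ltgtP j' k.+1%:Z;
    rewrite /= => h; try by have := hd ord0 u; have := hd ord_max u'; lia.
  move: h; rewrite jK jK' ltxx eqxx /=.
  case: u u' => [|i u] [|i' u'] /=; rewrite ?seq_le_nil; try lia.
  + by have := ltn_ord i; lia.
  + by have -> : (i == i') = (i == i' :> nat) by []; lia.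
- have [jK|Kj] := ltP j k.+1%:Z; have [jK'|Kj'] := ltP j' k.+1%:Z => /=; try lia.
  + by have [jN|Nj] := leP j' (k.+1%:Z + N%:Z) => /=; lia.
  + have [jN|Nj] := leP j (k.+1%:Z + N%:Z);
      have [jN'|Nj'] := leP j' (k.+1%:Z + N%:Z) => /= h; try lia.
    have eqE (i i' : digit) : (i == i') = (i == i' :> nat) by [].
    rewrite ltxx eqxx eqE /= !inordK; lia.
Qed.

(** For each letter, the index above which a left edge costs is at least the index up to which a
    right edge costs. *)
Lemma cost_le1 a (e e' : edge) : (a.1 <= N)%N -> edge_le e e' ->
  (costL N a e.1 + costR N a e'.1 <= 1)%N.
Proof. by move=> aN /edge_le_fst; case: a aN => [[|k] []] /=; lia. Qed.

Definition edge_run d (w : word nat) (e : edge) := foldr (edge_act d) e w.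

Lemma point_of_run d w e : point_of d (edge_run d w e) = wact w (point_of d e).
Proof. by elim: w => //= a w <-; rewrite point_of_act. Qed.

(** Each letter of [w] extends [l] and [r] by the words of [simL_letter] and [simR_letter], which by
    [cost_le1] have at most one letter together. *)
Lemma excision w e e' m m' : generator_word w -> edge_le e e' ->
  wfL N e.1 m -> wfR N e'.1 m' ->
  exists l r p p', [/\ generator_word (r ++ l),
    (size (r ++ l) <= size w)%N,
    wfL N (edge_run ord0 w e).1 p /\ wfR N (edge_run ord_max w e').1 p',
    sim true (wact w) (wact l) (normL e m) (posL e m)
      (normL (edge_run ord0 w e) p) (posL (edge_run ord0 w e) p) &
    sim false (wact w) (wact r) (normR e' m') (posR e' m')
      (normR (edge_run ord_max w e') p') (posR (edge_run ord_max w e') p')].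
Proof.
move=> gw ee wL wR.
elim: w gw => [|a w IH] /=.
  by exists [::], [::], m, m'; split=> //; apply: sim_id.
move=> /andP[aN /IH[l [r [p [p' [glr slr [wL' wR'] sL sR]]]]]].
have eew : edge_le (edge_run ord0 w e) (edge_run ord_max w e').
  by elim: w {IH glr slr wL' wR' sL sR} => //= b w; apply: edge_le_act.
have [l1 [p1 [w1 s1 g1 sL1]]] := simL_letter aN wL'.
have [r1 [p1' [w1' s1' g1' sR1]]] := simR_letter aN wR'.
exists (l1 ++ l), (r1 ++ r), p1, p1'; split=> //.
- by move: glr g1 g1'; rewrite /generator_word !all_cat => /andP[-> ->] -> ->.
- move: slr; rewrite !size_cat addnACA -add1n; apply: leq_add.
  by apply: leq_trans (leq_add s1' s1) _; rewrite addnC cost_le1.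
- have -> : @wact N (l1 ++ l) = wact l1 \o wact l.
    by apply: funext => z; apply: wact_cat.
  exact: sim_comp sL sL1.
- have -> : @wact N (r1 ++ r) = wact r1 \o wact r.
    by apply: funext => z; apply: wact_cat.
  exact: sim_comp sR sR1.
Qed.

Lemma consts_nseq (d : digit) u :
  foldr (@scons N) (fun=> d) u = (fun=> d) -> u = nseq (size u) d.
Proof.
elim: u => //= i u IH e.
have e' : scons d (fun=> d) = (fun=> d) by apply: funext => -[].
by have [-> /IH {1}->] := scons_inj (etrans e (esym e')).
Qed.

Lemma point_of_eq (d : digit) (e : edge) (j : int) :
  point_of d e = (j, fun=> d) -> e = (j, nseq (size e.2) d).
Proof. by case: e => i u [-> /consts_nseq{1}->]. Qed.

Lemma markL_zeros c j : markL j (nseq c (ord0 : digit)) = j.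
Proof. by elim: c => //= c; rewrite addr0. Qed.

Lemma markR_tops c j : markR j (nseq c (ord_max : digit)) = j.
Proof. by elim: c => //= c; rewrite addrK. Qed.

(* Excision of the trees k, ..., k + N; the residue of k modulo N is preserved,
   whence k = k'. *)
Lemma merged_shortcut w (k k' : nat) : generator_word w ->
  (0 < k <= N)%N -> (0 < k' <= N)%N ->
  (forall (i : digit) (u : stream), wact w (k%:Z + i%:Z, u) = (k'%:Z + i%:Z, u)) ->
  exists v, [/\ generator_word v, (size v <= size w)%N &
    forall z : point, wact v z = merge k'%:Z (wact w (expand k%:Z z))].
Proof.
move=> gw kN kN' hw.
(* The right edge starts in tree [k + N], beyond the first block, hence the offset 1. Both markers
   are then at [k], which closes the gap. *)
have [|||l [r [p [p' [glr slr [wL wR] sL sR]]]]] :=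
    @excision w (k%:Z, [::]) (k%:Z + N%:Z, [::]) 0 1 gw.
- by rewrite /edge_le /=; lia.
- by rewrite /wfL /=; lia.
- by rewrite /wfR /=; lia.
have eL : point_of (ord0 : digit) (edge_run ord0 w (k%:Z, [::])) =
    (k'%:Z, fun=> ord0).
  by have := hw ord0 (fun=> ord0); rewrite !addr0 point_of_run.
have eR : point_of (ord_max : digit) (edge_run ord_max w (k%:Z + N%:Z, [::])) =
    (k'%:Z + N%:Z, fun=> ord_max).
  by have := hw ord_max (fun=> ord_max); rewrite point_of_run.
move: wL wR sL sR; rewrite (point_of_eq eL) (point_of_eq eR).
move: (size _) (size _) => cR cL; rewrite /wfL /wfR /= => wL wR.
have p0 : p = 0 by lia.
have p'1 : p' = 1.
  have /small_multiple : - N%:Z < (p' - 1) * N%:Z < N%:Z by lia.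
  lia.
rewrite /sim /posL /posR /normL /normR {}p0 {}p'1 /= markL_zeros markR_tops.
rewrite mul1r mul0r !addr0 !addrK => -[[q kq fixL] inL hL] [[q' kq' fixR] inR hR].
have q0 : q = 0 by apply: (@small_multiple N); lia.
have {kq} kk : k' = k by move: kq; rewrite q0; lia.
subst k'.
have q'0 : q' = 0 by apply: (@small_multiple N); lia.
have {}fixL (z : point) : k%:Z <= z.1 -> wact l z = z.
  by move=> h; rewrite fixL; [rewrite q0 mul0r shift0 | rewrite /= -leNgt].
have {}fixR (z : point) : z.1 <= k%:Z -> wact r z = z.
  by move=> h; rewrite fixR; [rewrite q'0 mul0r shift0 | rewrite /= -leNgt].
(* [l] fixes what is at [k] or beyond and [r] what is at [k] or before, so the composite acts by [l]
   on the left and by [r] on the right. The final branches have digits 0, resp. [N], only, and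
   dissolving them affects neither side. *)
exists (r ++ l); split=> // z; rewrite wact_cat.
case: (expandP k%:Z z) => [{}z zk|i u|j u kj].
- have := hL z; rewrite /= !shift0 addr0 => /(_ zk) e.
  have lk := inL _ zk; have := lk; rewrite -{1}e => /dissolveL_zeros.
  by rewrite e expandL // => <-; rewrite mergeL // fixR // ltW.
- by rewrite expandI hw mergeI fixL // fixR.
- rewrite expandR // /shift /= fixL /=; last exact: ltW.
  have zj : shift (- N%:Z) (j + N%:Z, u) = (j, u) by rewrite /shift /= addrK.
  have := hR (j + N%:Z, u); rewrite zj /= addrK => /(_ kj) e.
  have := inR (j, u) kj; rewrite -[wact r (j, u)]e /= => lk.
  rewrite dissolveR_tops; last lia.
  by rewrite mergeR //; move: (lk); rewrite dissolveR_tops; lia.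
Qed.

Hypothesis N0 : (0 < N)%N.

(** The ends below the vertex [e]. If [f] maps [cone e u] to [(k, u)] for all [u], then tree [k] of
    [f] is trivial. *)
Definition cone (e : edge) (u : stream) : point :=
  (e.1, foldr (@scons N) u e.2).

(* Excision of tree N + 1, which becomes child 1 of tree N under merge N. *)
Lemma child_shortcut w (k : nat) : generator_word w -> (0 < k <= N)%N ->
  (forall u : stream,
     wact w (cone (N%:Z, [:: inord 1]) u) = (k%:Z, u)) ->
  exists v, [/\ generator_word v, (size v <= size w)%N &
    forall z : point, wact v z = wact w (merge N%:Z z)].
Proof.
move=> gw kN hw; have d1 : (inord 1 : digit) = 1%N :> nat by rewrite inordK.
(* One vertex supplies both edges, as its extreme ends. Dissolving puts it at tree [N + 1] for the
   left path and, by the shift in [dissolveR], at tree 1 for the right path. *)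
pose e : edge := (N%:Z, [:: inord 1]).
have [||l [r [p [p' [glr slr [wL wR] sL sR]]]]] :=
    @excision w e e 0 0 gw (edge_le_refl e).
- by rewrite /wfL /=; lia.
- by rewrite /wfR /=; lia.
have eL : point_of (ord0 : digit) (edge_run ord0 w e) = (k%:Z, fun=> ord0).
  by rewrite point_of_run -hw.
have eR : point_of (ord_max : digit) (edge_run ord_max w e) =
    (k%:Z, fun=> ord_max).
  by rewrite point_of_run -hw.
move: wL wR sL sR; rewrite (point_of_eq eL) (point_of_eq eR).
move: (size _) (size _) => cR cL; rewrite /wfL /wfR /= => wL wR.
have p0 : p = 0 by lia.
have p'0 : p' = 0 by lia.
rewrite /sim /posL /posR /normL /normR {}p0 {}p'0 /= markL_zeros markR_tops d1.
rewrite mul0r oppr0 !addr0 => -[[q kq fixL] inL hL] [[q' kq' fixR] inR hR].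
(* [k = N + 1 + q N] lies between 1 and [N], so [q = -1] and [k = 1]. *)
have q0 : q + 1 = 0 by apply: (@small_multiple N); lia.
have qN : q * N%:Z = - N%:Z by rewrite (_ : q = -1) ?mulN1r //; lia.
have k1 : k%:Z = 1 by lia.
have q'0 : q' = 0 by apply: (@small_multiple N); lia.
rewrite {}k1 {kq kq' wL wR eL eR kN} in hw hL hR inL inR.
have {}fixL (z : point) : N%:Z + 1 <= z.1 -> wact l z = shift (- N%:Z) z.
  by move=> h; rewrite fixL ?qN //= -leNgt.
have {}fixR (z : point) : z.1 <= 1 -> wact r z = z.
  by move=> h; rewrite fixR; [rewrite q'0 mul0r shift0 | rewrite /= -leNgt; lia].
exists (r ++ l); split=> // z; rewrite wact_cat.
have [zN|Nz|zN] := ltgtP z.1 (N%:Z + 1).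
- have := hL (merge N%:Z z); rewrite mergeK !shift0 addr0 => /(_ zN) h.
  have lk := inL _ zN; have := lk; rewrite -{1}h => /dissolveL_zeros.
  by rewrite h => <-; rewrite fixR // ltW.
- have Nz' : 1 < z.1 - N%:Z by lia.
  rewrite fixL; last exact: ltW.
  have := hR (merge N%:Z z); rewrite mergeK !shift0 => h.
  have lk : 1 < (wact r (shift (- N%:Z) z)).1 by apply: inR => /=; lia.
  move: (lk); rewrite -h /=; last lia.
  by move=> /dissolveR_tops ->.
- case: z zN => j u /= ->.
  rewrite fixL // fixR /=; last by lia.
  have := hw u; rewrite /cone /= -mergeI d1 => ->.
  by rewrite /shift /=; congr (_, _); lia.
Qed.

(** A letter can break a subtree only by opening its root caret, and then the subtree is a whole
    tree of the row. *)
Lemma cone_act a e : (a.1 <= N)%N ->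
  (exists e', forall u, lact a (cone e u) = cone e' u) \/
  (exists k : nat, [/\ (0 < k <= N)%N, a = (k, true) & e = (k%:Z, [::])]).
Proof.
case: a e => [[|k] []] [j u] /= aN.
- by left; exists (j + N%:Z, u).
- by left; exists (j - N%:Z, u).
- have [jk|kj|->] := ltgtP j k.+1%:Z.
  + by left; exists (j, u) => v; rewrite expandL.
  + by left; exists (j + N%:Z, u) => v; rewrite expandR.
  + case: u => [|i u]; first by right; exists k.+1.
    by left; exists (k.+1%:Z + i%:Z, u) => v; rewrite /cone /= expandI.
- left; have [jk|kj] := ltP j k.+1%:Z.
    by exists (j, u) => v; rewrite mergeL.
  have [jN|Nj] := leP j (k.+1%:Z + N%:Z).
    exists (k.+1%:Z, inord `|j - k.+1%:Z|%N :: u) => v.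
    rewrite /cone /= -mergeI; congr (merge _ (_, _)); rewrite inordK; lia.
  by exists (j - N%:Z, u) => v; rewrite mergeR.
Qed.

Lemma word_switch (P : word nat -> Prop) w : ~ P [::] -> P w ->
  exists w2 a w1, [/\ w = w2 ++ a :: w1, ~ P w1 & P (a :: w1)].
Proof.
move=> P0; elim: w => // a w IH Paw.
have [/IH[w2 [b [w1 [-> ? ?]]]]|nPw] := pselect (P w).
  by exists (a :: w2), b, w1.
by exists [::], a, w.
Qed.

(** The pieces of the opened tree [k] end up in one subtree, so some letter [x_k'] joins them again.
    Dropping it and excising the pieces from the path before it saves a letter. *)
Lemma expand_shortcut w (k : nat) : generator_word w -> (0 < k <= N)%N ->
  (exists e, forall u : stream, wact w (expand k%:Z (k%:Z, u)) = cone e u) ->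
  exists v, [/\ generator_word v, (size v < size w)%N &
    forall z : point, wact v z = wact w (expand k%:Z z)].
Proof.
move=> gw kN hw.
pose P v := exists e, forall u : stream, wact v (expand k%:Z (k%:Z, u)) = cone e u.
have [|w2 [[i b] [w1 [ew nw1 [e he]]]]] := @word_switch P w _ hw.
  (* Right after the opening, children 0 and [N] lie in the distinct trees [k] and [k + N]. *)
  move=> [e he]; have h (i : digit) := he (scons i (fun=> ord0)).
  have := h ord0; have := h ord_max; rewrite /= !expandI /cone => -[<- _] [].
  by rewrite /= => e0 _; lia.
move: gw; rewrite ew {1}/generator_word all_cat /=.
case/and3P => gw2 iN gw1.
have inv u : wact w1 (expand k%:Z (k%:Z, u)) = lact (i, ~~ b) (cone e u).
  by rewrite -he wact_cons; have := @lactK N i (~~ b); rewrite negbK => ->.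
(* The inverse of the reassembling letter breaks the subtree, so it is some [x_k'^-1]. *)
have [[e' he']|[k' [kN' [ei eb] ee]]] := @cone_act (i, ~~ b) e iN.
  by case: nw1; exists e' => u; rewrite inv he'.
have {eb}b0 : b = false by rewrite -[b]negbK eb.
have lk z : lact (k', false) z = merge k'%:Z z :> point.
  by move: kN'; case: (k').
subst e i b.
have [|v [gv sv ev]] := merged_shortcut gw1 kN kN'.
  move=> i u; rewrite -expandI inv /cone /=.
  by move: kN'; case: (k') => //= m _; rewrite expandI.
exists (w2 ++ v); split.
- by rewrite /generator_word all_cat gw2.
- by rewrite !size_cat /= addnS ltnS leq_add2l.
- by move=> z; rewrite !wact_cat wact_cons ev lk.
Qed.

(** Tree [N + 1], now child 1 of tree [N], gets broken by some letter [x_k^-1] while it fills tree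
    [k]. It is excised from the path before that letter, which itself is kept. *)
Lemma merge_shortcut w : generator_word w ->
  ~ (exists e, forall u : stream, wact w (merge N%:Z (N.+1%:Z, u)) = cone e u) ->
  exists v, [/\ generator_word v, (size v <= size w)%N &
    forall z : point, wact v z = wact w (merge N%:Z z)].
Proof.
move=> gw hw.
pose P v := ~ exists e, forall u : stream,
  wact v (merge N%:Z (N.+1%:Z, u)) = cone e u.
have NE u : merge N%:Z (N.+1%:Z, u) = cone (N%:Z, [:: inord 1]) u :> point.
  rewrite /cone /= -mergeI; congr (merge _ (_, _)); rewrite inordK; lia.
have [|w2 [[i b] [w1 [ew /contrapT[e he] nw1]]]] := @word_switch P w _ hw.
  by apply; exists (N%:Z, [:: inord 1]).
move: gw; rewrite ew {1}/generator_word all_cat /=.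
case/and3P => gw2 iN gw1.
have [[e' he']|[k [kN [ei eb] ee]]] := @cone_act (i, b) e iN.
  by case: nw1; exists e' => u; rewrite wact_cons he he'.
subst e i b.
have [|v [gv sv ev]] := child_shortcut gw1 kN.
  by move=> u; rewrite -NE he.
exists (w2 ++ (k, true) :: v); split.
- by rewrite /generator_word all_cat gw2 /= iN.
- by rewrite !size_cat /= leq_add2l.
- by move=> z; rewrite !wact_cat !wact_cons ev.
Qed.
End Surgery.

(** * Word length *)

Section Length.
Variable N : nat.
Local Notation digit := 'I_N.+1.
Local Notation stream := (nat -> digit).
Local Notation point := (int * stream)%type.
Local Notation rels := (thompson_rels N.+1).
Local Notation gens := (thompson_gens N.+1).
Local Notation x := (thompson_x N.+1).
Local Notation len := (word_length gens).
Local Notation generator_word := (generator_word N).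
Local Open Scope group_scope.

Hypothesis N0 : (0 < N)%N.

Lemma gens_generate : generates gens.
Proof. exact: thompson_generated. Qed.

Lemma letters_word s : letters gens s ->
  exists2 a : nat * bool, (a.1 <= N)%N & s = word_class rels [:: a].
Proof.
case=> -[i /= iN e]; first by exists (i, false).
by exists (i, true) => //; rewrite -[s]invgK -e; apply: presented_invE.
Qed.

Lemma word_letters (a : nat * bool) : (a.1 <= N)%N ->
  letters gens (word_class rels [:: a]).
Proof.
case: a => i [] /= iN; last by left; exists i.
by right; exists i => //; apply: esym; apply: presented_invE.
Qed.

Lemma is_product_word k g : is_product gens k g ->
  exists w, [/\ generator_word w, size w = k & word_class rels w = g].
Proof.
move=> [ss [<- ssP ->]] {k g}; elim: ss ssP => [|s ss IH] ssP.
  by exists [::]; rewrite big_nil.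
have [|w [gw sw ew]] := IH; first by move=> t tss; apply: ssP; rewrite inE tss orbT.
have [a aN ea] := letters_word (ssP s (mem_head _ _)).
exists (a :: w); rewrite big_cons -ew ea -word_class_cat /= sw; split=> //.
by rewrite /generator_word /= aN.
Qed.

Lemma word_is_product w : generator_word w ->
  is_product gens (size w) (word_class rels w).
Proof.
elim: w => [_|a w IH /= /andP[aN /IH gw]]; first exact: is_product1.
rewrite -cat1s word_class_cat -(add1n (size w)); apply: is_productM gw.
exact/is_product_letter/word_letters.
Qed.

Lemma len_min k g : is_product gens k g -> (len g <= k)%N.
Proof. by have [_] := word_lengthP g gens_generate; apply. Qed.

Lemma len_product g : is_product gens (len g) g.
Proof. by have [] := word_lengthP g gens_generate. Qed.

Lemma len_leM k g h : is_product gens k h -> (len (h * g) <= k + len g)%N.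
Proof. by move=> hk; apply/len_min/(is_productM hk)/len_product. Qed.

Lemma len_geM k g h : is_product gens k h -> (len g <= k + len (h * g))%N.
Proof.
by move=> /is_productV hk; rewrite -{1}(mulKg h g); apply: len_leM.
Qed.

Lemma lenV_le k g : is_product gens k g^-1 -> (len g <= k)%N.
Proof. by move=> /is_productV; rewrite invgK => /len_min. Qed.

Lemma word_equiv_odd_size u v : word_equiv rels u v -> odd (size u) = odd (size v).
Proof.
elim=> {u v} // [_ _ []|u u' v v' _ IHu _ IHv|u v w _ -> _ ->] //.
by rewrite !size_cat !oddD IHu IHv.
Qed.

Lemma is_product_odd k l g : is_product gens k g -> is_product gens l g ->
  odd k = odd l.
Proof.
move=> /is_product_word[v [_ <- <-]] /is_product_word[w [_ <-]].
by move=> /word_classP/word_equiv_odd_size.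
Qed.

Lemma letter_len_neq s g : letters gens s -> len (s * g) != len g.
Proof.
move=> /is_product_letter/is_productM/(_ (len_product g)).
move=> /(is_product_odd (len_product (s * g))) /=.
by apply: contra_eqN => /eqP ->; case: odd.
Qed.

Lemma x_letters i : (i <= N)%N -> letters gens (x i).
Proof. by move=> iN; left; exists i. Qed.

(** A shortest word for the inverse of [x_k^-1 f], applied after [expand], acts as [f^-1];
    [expand_shortcut] makes it a shorter word for [f^-1]. *)
Lemma len_expand f k : (0 < k <= N)%N ->
  (exists e, forall u : stream, act f (cone e u) = (Posz k, u)) ->
  (len f < len ((x k)^-1 * f))%N.
Proof.
move=> kN [e he].
have lk b (z : point) :
    lact (k, b) z = if b then expand (Posz k) z else merge (Posz k) z.
  by move: kN; case: (k) => //= m _; case: b.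
have [w [gw sw ew]] := is_product_word (is_productV (len_product ((x k)^-1 * f))).
have wE z : wact w z = act f^-1 (merge (Posz k) z).
  by rewrite -act_class ew invgM invgK actM act_x lk.
have [|v [gv sv ev]] := expand_shortcut N0 gw kN.
  by exists e => u; rewrite wE expandK -he actKV.
rewrite -sw; apply: leq_ltn_trans sv; apply: lenV_le.
suff <- : word_class rels v = f^-1 by apply: word_is_product.
by apply: (act_faithful N0) => z; rewrite act_class ev wE expandK.
Qed.

Lemma len_merge f :
  ~ (exists e, forall u : stream, act f (cone e u) = (Posz N.+1, u)) ->
  (len f <= len (x N * f))%N.
Proof.
move=> hf.
have lN b (z : point) :
    lact (N, b) z = if b then expand (Posz N) z else merge (Posz N) z.
  by move: N0 z; case: (N) => //= m _; case: b.
have [w [gw sw ew]] := is_product_word (is_productV (len_product (x N * f))).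
have wE z : wact w z = act f^-1 (expand (Posz N) z).
  by rewrite -act_class ew invgM actM act_xV lN.
have [|v [gv sv ev]] := merge_shortcut N0 gw.
  by case=> e he; apply: hf; exists e => u; rewrite -he wE mergeK actVK.
rewrite -sw; apply: leq_trans sv; apply: lenV_le.
suff <- : word_class rels v = f^-1 by apply: word_is_product.
by apply: (act_faithful N0) => z; rewrite act_class ev wE mergeK.
Qed.

Lemma dead_end_escapes3 f : dead_end gens f -> escapes gens 3 f.
Proof.
move=> df; have [[e he]|nf] :=
    pselect (exists e, forall u : stream, act f (cone e u) = (Posz N.+1, u)); last first.
  (* Tree [N + 1] is nontrivial: [x_N] does not shorten [f], hence lengthens it by parity, which a
     dead end forbids. *)
  have xN := x_letters (leqnn N).
  have := letter_len_neq f xN; rewrite eqn_leq df //=.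
  by rewrite len_merge.
(* [x_0] brings the trivial tree [N + 1] to index 1. *)
have h1 u : act (x 0 * f) (cone e u) = (Posz 1, u).
  by rewrite actM he act_x /= /shift /=; congr (_, _); lia.
(* Child 0 of the opened tree is again a trivial tree 1, so [x_1^-1] lengthens once more. *)
have h2 u : act ((x 1)^-1 * (x 0 * f)) (cone (e.1, rcons e.2 ord0) u) = (Posz 1, u).
  have -> : cone (e.1, rcons e.2 ord0) u = cone e (scons ord0 u).
    by rewrite /cone /= foldr_rcons.
  by rewrite actM h1 act_xV /= expandI addr0.
have x1 : letters gens (x 1)^-1 by apply: lettersV; apply: x_letters.
have p0 := is_product_letter (x_letters (leq0n N)); have p1 := is_product_letter x1.
exists ((x 1)^-1 * ((x 1)^-1 * x 0)); split.
  exact: (is_productM p1 (is_productM p1 p0)).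
(* [x_0] loses at most one, then each [x_1^-1] gains at least one. *)
have l0 := len_geM f p0.
have l1 : (len (x 0 * f) < len ((x 1)^-1 * (x 0 * f)))%N.
  by apply: len_expand; [rewrite N0 | exists e].
have l2 : (len ((x 1)^-1 * (x 0 * f)) < len ((x 1)^-1 * ((x 1)^-1 * (x 0 * f))))%N.
  by apply: len_expand; [rewrite N0 | exists (e.1, rcons e.2 ord0)].
by rewrite -!mulgA; apply: leq_ltn_trans l2; apply: leq_trans l0 l1.
Qed.

Lemma dead_end_escapes f j : dead_end gens f -> escapes gens j.+1 f -> (2 <= j)%N.
Proof.
move=> df [h [[ss [sj sP ->]]]].
case: ss sj sP => [|s [|t [|r ss]]] //= [<-] sP //.
- by rewrite big_seq1 ltnNge df //; apply: sP; rewrite mem_head.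
- have [sS tS] : letters gens s /\ letters gens t.
    by split; apply: sP; rewrite !inE eqxx ?orbT.
  rewrite big_cons big_seq1 -mulgA ltnNge.
  (* By parity the first letter strictly shortens [f]; the second regains at most one. *)
  have tf : (len (t * f) < len f)%N by rewrite ltn_neqAle letter_len_neq // df.
  by rewrite (leq_trans (len_leM _ (is_product_letter sS))).
Qed.
End Length.

Theorem proposition6p5 (n : nat) (hn : 2 <= n) (f : thompson n)
    (hf : dead_end (thompson_gens n) f) :
  has_depth (thompson_gens n) 2 f.
Proof.
case: n hn f hf => [//|N] N0 f hf; split; first exact: dead_end_escapes3.
by move=> j; apply: dead_end_escapes.
Qed.
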